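(* Consider the Gaussian broadcast model on $P=\mathbb{Z}_{\ge0}^2$ with $(\alpha_1,\alpha_2)=(1,1/2)$. For every integer $t\ge0$, the random variable $$\widehat\zeta:=\sum_{i=0}^t\binom{t}{i}X_{(i,t-i)}$$ maximizes $\zeta\mapsto \operatorname{Cov}(\zeta,X_0)/\sqrt{\operatorname{Var}(\zeta)}$ over all nonzero linear combinations $\zeta=\sum_{i=0}^t c_iX_{(i,t-i)}$ (with $c_i\in\mathbb R$ not all zero), and $$\frac{\operatorname{Cov}(\widehat\zeta,X_0)}{\sqrt{\operatorname{Var}(\widehat\zeta)}}=\frac{1}{\sqrt{\frac{t}{4^t}\binom{2t}{t}+1}}.$$
   Context: Gaussian broadcast model: Let $d\ge 0$ and let $P$ be an infinite graded poset with layers $L_0,L_1,\dots$ ($L_t$ = elements of rank $t$, $L_0$ = minimal elements), in which every element covers at most $d+1$ elements. For $v\in P$ let $\mathfrak p(v)$ be the set of elements covered by $v$. Given $\alpha_1,\dots,\alpha_{d+1}>0$, let $X_0\sim\mathcal N(0,1)$ and, independently, let $W_{u\to v}$ be i.i.d. $\mathcal N(0,1)$ indexed by covering pairs $u\lessdot v$. Set $X_v=X_0$ for $v\in L_0$, and for $v$ of rank $\ge1$ set $X_v=\alpha_{|\mathfrak p(v)|}\sum_{u\in\mathfrak p(v)}(X_u+W_{u\to v})$. Here $d=1$ and $P=\mathbb{Z}_{\ge0}^2$ with the componentwise order; $L_t=\{(i,t-i):0\le i\le t\}$; $|\mathfrak p(v)|$ is the number of positive coordinates of $v$. *)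

(* Defs.v *)
From HB Require Import structures.
From mathcomp Require Import all_boot all_order all_algebra.
From mathcomp Require Import all_classical all_reals all_analysis.
Set Implicit Arguments. Unset Strict Implicit. Unset Printing Implicit Defensive.
Import Order.TTheory GRing.Theory Num.Theory.
Local Open Scope classical_set_scope.
Local Open Scope ring_scope.

Definition mutually_independent {d} {T : measurableType d} {R : realType}
  (P : probability T R) {I : eqType} (Y : I -> T -> R) : Prop :=
  forall (s : seq I), uniq s ->
  forall B : I -> set R, (forall i, measurable (B i)) ->
  P (\bigcap_(i in [set` s]) (Y i @^-1` B i)) =
  (\prod_(i <- s) P (Y i @^-1` B i))%E.

(* Edge noises on P = Z_{>=0}^2: W i j true is W_{(i,j) -> (i+1,j)},
   W i j false is W_{(i,j) -> (i,j+1)}.  This indexes every covering pair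
   exactly once. *)
Definition bfamily {T R : Type} (X0 : T -> R) (W : nat -> nat -> bool -> T -> R)
  (k : option ((nat * nat) * bool)) : T -> R :=
  match k with
  | None => X0
  | Some (u, b) => W u.1 u.2 b
  end.

Fixpoint bX {T : Type} {R : ringType} (a1 a2 : R) (X0 : T -> R)
  (W : nat -> nat -> bool -> T -> R) (i : nat) {struct i} : nat -> T -> R :=
  fix bXi (j : nat) : T -> R :=
  match i, j with
  | 0, 0 => X0
  | i'.+1, 0 => fun w => a1 * (bX a1 a2 X0 W i' 0 w + W i' 0 true w)
  | 0, j'.+1 => fun w => a1 * (bXi j' w + W 0 j' false w)
  | i'.+1, j'.+1 => fun w =>
      a2 * ((bX a1 a2 X0 W i' j'.+1 w + W i' j'.+1 true w)
          + (bXi j' w + W i'.+1 j' false w))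
  end.

Definition corr_ratio {d} {T : measurableType d} {R : realType}
  (P : probability T R) (Z Y : T -> R) : R :=
  fine (covariance P Z Y) / Num.sqrt (fine ('V_P[Z])).

(* Main.v *)
Require Import Defs.
From HB Require Import structures.
From mathcomp Require Import all_boot all_order all_algebra.
From mathcomp Require Import all_classical all_reals all_analysis.
From mathcomp Require Import measurable_realfun zify ring lra.
Import Order.TTheory GRing.Theory Num.Theory.
Import numFieldNormedType.Exports.
Local Open Scope classical_set_scope.
Local Open Scope ring_scope.

(** Let [m_t(i) = E|B - i|] with [B] binomial [(t, 1/2)].  By induction on the
    layer, the covariances on the layer [L_t] are
      [Cov(X_(i,t-i), X_(k,t-k)) = 1 + m_t(i) + m_t(k) - |i - k|].
    Averaging over [k] with the binomial weights turns [|i - k|] into [m_t(i)],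
    so [Cov(X_(i,t-i), zhat)] does not depend on [i]; it equals
    [2^t (1 + E|B - B'|)] with [B'] an independent copy of [B].  As every
    [X_v] has covariance 1 with [X_0], [Cov(zeta, zhat)] is proportional to
    [Cov(zeta, X_0)] for every [zeta], and the Cauchy-Schwarz inequality shows
    that [zhat] is optimal.  Finally [E|B - B'| = t 4^-t 'C(2t, t)]. *)

(** * Mean distance to a binomial variable *)

(** One fair coin: the expectation of [g (x - b)] for [b] uniform on 0 and 1. *)
Definition half_avg (R : fieldType) (g : int -> R) (x : int) : R :=
  2^-1 * (g x + g (x - 1)).

(** This is $m_t(x)$, built up one coin at a time. The argument lives in [int], so that [x - 1] is
    not truncated at 0. *)
Definition mean_dist (R : numFieldType) (t : nat) : int -> R :=
  iter t (@half_avg R) (fun x => `|x|%:~R).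

Arguments mean_dist : simpl never.

Lemma mean_distS (R : numFieldType) t x :
  mean_dist R t.+1 x = 2^-1 * (mean_dist R t x + mean_dist R t (x - 1)).
Proof. by []. Qed.

(** As $B \ge 0 \ge x$, the absolute value opens and only the mean $t/2$ of $B$ remains. *)
Lemma mean_dist_le0 (R : numFieldType) t x : x <= 0 ->
  mean_dist R t x = t%:R / 2 - x%:~R.
Proof.
elim: t x => [|t IH] x x0; first by rewrite mul0r sub0r /mean_dist /= ler0_norm// rmorphN.
rewrite mean_distS !IH//; last by lia.
by rewrite rmorphB -natr1 /=; field.
Qed.

(** Mirror case: $B \le t \le x$. *)
Lemma mean_dist_ge (R : numFieldType) (t : nat) (x : int) : t%:Z <= x ->
  mean_dist R t x = x%:~R - t%:R / 2.
Proof.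
elim: t x => [|t IH] x x0; first by rewrite mul0r subr0 /mean_dist /= ger0_norm.
rewrite mean_distS !IH//; [|by lia|by lia].
by rewrite rmorphB -natr1 /=; field.
Qed.

Lemma mean_dist_succ (R : numFieldType) t (i : nat) :
  mean_dist R t.+1 i.+1%:Z = 2^-1 * (mean_dist R t i.+1%:Z + mean_dist R t i%:Z).
Proof. by rewrite mean_distS; congr (_ * (_ + mean_dist R t _)); lia. Qed.

Lemma mean_dist_left (R : numFieldType) t :
  mean_dist R t 0%N%:Z = t%:R / 2.
Proof. by rewrite mean_dist_le0// subr0. Qed.

Lemma mean_dist_right (R : numFieldType) t :
  mean_dist R t t%:Z = t%:R / 2.
Proof. by rewrite mean_dist_ge// -[t%:~R]/(t%:R); field. Qed.

(** Pascal's rule shows that $t$ coin steps amount to averaging over a binomial variable. This links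
    the recursive form of [mean_dist] with explicit binomial sums. *)
Lemma iter_half_avg (R : numFieldType) (g : int -> R) t x :
  \sum_(k < t.+1) 'C(t, k)%:R * g (x - k%:Z)
  = 2 ^+ t * iter t (@half_avg R) g x.
Proof.
elim: t x => [|t IH] x.
  by rewrite big_ord_recl big_ord0 bin0 subr0 addr0 expr0.
rewrite iterS /half_avg exprSr -mulrA mulVKf ?pnatr_eq0// mulrDr -!IH.
rewrite big_ord_recl [in X in _ = X + _]big_ord_recl /= !bin0 -addrA; congr (_ + _).
under eq_bigr => i _ do rewrite /bump /= add1n binS natrD mulrDl.
rewrite big_split /= big_ord_recr /= bin_small// mul0r addr0; congr (_ + _).
apply: eq_bigr => i _; congr (_ * g _); lia.
Qed.

(** The function $|x|$ is linear except for its kink at 0. The weights 1, 2, 1 are those of two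
    successive half averages. *)
Lemma dist_second_difference (x : int) :
  `|x + 1| + `|x| *+ 2 + `|x - 1| = `|x| *+ 4 + (x == 0)%:Z *+ 2.
Proof. by lia. Qed.

Lemma central_binomialS t :
  (t.+1 * 'C(t.+1.*2, t.+1) = 2 * (t.*2.+1 * 'C(t.*2, t)))%N.
Proof.
have h1 := mul_bin_diag t.+1.*2 t.
have h2 := mul_bin_down t.*2.+1 t.
rewrite doubleS /= in h1 h2 *.
have e : (t.*2.+1 - t = t.+1)%N by lia.
by rewrite h2 e -h1; nia.
Qed.

(** Two more coins, with the centre moved by one, raise the mean distance by half the probability
    that $2t$ coins give exactly $t$ heads. By [central_binomialS] the closed form obeys the same
    recurrence. *)
Lemma mean_dist_central (R : numFieldType) t :
  mean_dist R t.*2 t%:Z = t%:R / 4 ^+ t * 'C(t.*2, t)%:R.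
Proof.
have p2 n : (2 : R) ^+ n != 0 by rewrite expf_neq0// pnatr_eq0.
have e4 n : (4 : R) ^+ n = 2 ^+ n.*2.
  by rewrite -mul2n exprM; congr (_ ^+ _); rewrite -natrX.
have step u : mean_dist R u.+1.*2 u.+1%:Z
    = mean_dist R u.*2 u%:Z + 2^-1 * ('C(u.*2, u)%:R / 4 ^+ u).
  (* Scaled by $2^{2u}$, both sides are binomial sums with the same weights. [iterSr] puts the two
     extra coins next to $|x|$, so the sums can be compared term by term. *)
  rewrite e4; apply: (mulfI (p2 u.*2)).
  rewrite mulrDr [in X in _ = _ + X]mulrCA [in X in _ = _ + X]mulrC.
  rewrite [2 ^+ u.*2 * (_ / _)]mulrC divfK//.
  rewrite doubleS /mean_dist !iterSr -!iter_half_avg.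
  have lt_u : (u < u.*2.+1)%N by lia.
  rewrite (bigD1 (Ordinal lt_u)) //= [in RHS](bigD1 (Ordinal lt_u)) //=.
  have second_avg (k : nat) :
      half_avg R (half_avg R (fun x : int => `|x|%:~R : R)) (u.+1%:Z - k%:Z)
      = `|u%:Z - k%:Z|%:~R + (u == k)%:R / 2.
    rewrite /half_avg.
    have /= := congr1 (fun z : int => z%:~R : R) (dist_second_difference (u%:Z - k%:Z)).
    have -> : u.+1%:Z - k%:Z = u%:Z - k%:Z + 1 by lia.
    rewrite addrK subr_eq0 eqz_nat !rmorphD /=.
    move: (`|_ + 1|%:~R) (`|_ - _|%:~R) (`|_ - 1|%:~R) => a b c h.
    have -> : 2^-1 * (2^-1 * (a + b) + 2^-1 * (b + c))
        = (a + (b + b) + c) / 4 by field.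
    by rewrite h; field.
  (* The kink contributes only at $k = u$, which yields the increment; all other terms agree. *)
  rewrite second_avg eqxx subrr mulrDr addrAC; congr (_ + _); last by rewrite mulrA mulr1.
  congr (_ + _); apply: eq_bigr => i ni; rewrite second_avg.
  suff -> : (u == i :> nat) = false by rewrite mul0r addr0.
  by apply/negbTE; apply: contraNneq ni => e; apply/eqP/val_inj.
elim: t => [|t IH]; first by rewrite !mul0r.
rewrite step IH.
have h : t.+1%:R * 'C(t.+1.*2, t.+1)%:R
    = 2 * ((2 * t%:R + 1) * 'C(t.*2, t)%:R) :> R.
  by rewrite -natrM central_binomialS !natrM -[t.*2.+1%:R]natr1 -[X in X%:R + 1]mul2n natrM.
rewrite [RHS]mulrAC h exprS; field.
by rewrite e4 p2.
Qed.

(** The left side is $2^t E|B - B'|$. Since $t - B$ has the law of $B$, the difference $B - B'$ is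
    distributed as $t$ minus a sum of $2t$ coins, which is the central case. *)
Lemma sum_binomial_mean_dist (R : numFieldType) t :
  \sum_(i < t.+1) 'C(t, i)%:R * mean_dist R t i%:Z
  = 2 ^+ t * (t%:R / 4 ^+ t * 'C(t.*2, t)%:R).
Proof.
rewrite -mean_dist_central -addnn /mean_dist iterD -iter_half_avg.
rewrite (reindex_inj rev_ord_inj) /=; apply: eq_bigr => i _.
have it : (i <= t)%N by rewrite -ltnS.
by rewrite subSS bin_sub // subzn.
Qed.

Lemma sum_binomial (R : numFieldType) t :
  \sum_(i < t.+1) 'C(t, i)%:R = 2 ^+ t :> R.
Proof.
rewrite -[2]/(1 + 1) exprDn; apply: eq_bigr => i _.
by rewrite !expr1n mulr1.
Qed.

(** * Moments of the standard normal law *)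

Lemma Lfun2_sqr_integrable d (T : measurableType d) (R : realType)
  (mu : {measure set T -> \bar R}) (f : T -> R) :
  measurable_fun setT f -> mu.-integrable setT (fun x => (f x ^+ 2)%:E) ->
  f \in Lfun mu 2%:E.
Proof.
move=> mf /integrableP[_ fin]; rewrite inE; apply/andP; split; rewrite inE//=.
rewrite /finite_norm; apply: (@lty_poweRy _ _ 2) => //.
rewrite powR_Lnorm//; apply: le_lt_trans fin; apply: ge0_le_integral => //=.
- apply/measurable_EFinP; apply: (measurableT_comp (measurable_powR _)) => //.
  exact: measurableT_comp.
- by apply/measurable_EFinP; apply: measurableT_comp => //; exact: measurable_funX.
- by move=> x _; rewrite lee_fin powR_mulrn// normrX.
Qed.

(** The Radon-Nikodym derivative of the normal law has the same integral as [normal_pdf] over every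
    measurable set, so the two agree almost everywhere and may be exchanged. *)
Lemma ge0_integral_normal_prob (R : realType) (m s : R) (f : R -> \bar R) :
  measurable_fun setT f -> (forall x, (0 <= f x)%E) ->
  (\int[normal_prob m s]_x f x =
   \int[lebesgue_measure]_x (f x * (normal_pdf m s x)%:E))%E.
Proof.
move=> mf f0; have dom := normal_prob_dominates m s.
rewrite -(Radon_Nikodym_SigmaFinite.change_of_variables dom)//.
have mRN := measurable_int _ (Radon_Nikodym_SigmaFinite.f_integrable dom).
have mpdf : measurable_fun setT (fun x => (normal_pdf m s x)%:E).
  by apply/measurable_EFinP; exact: measurable_normal_pdf.
apply: ae_eq_integral => //; [exact: emeasurable_funM|exact: emeasurable_funM|].
apply: ae_eqe_mul2l; apply: integral_ae_eq => //.
  exact: Radon_Nikodym_SigmaFinite.f_integrable.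
by move=> E _ mE; rewrite -Radon_Nikodym_SigmaFinite.f_integral.
Qed.

(** Positive and negative parts are treated separately; the nonnegative density passes through the
    maximum that defines them. *)
Lemma integral_normal_prob (R : realType) (m s : R) (f : R -> R) :
  measurable_fun setT f ->
  (\int[normal_prob m s]_x (f x)%:E =
   \int[lebesgue_measure]_x (f x * normal_pdf m s x)%:E)%E.
Proof.
move=> mf; rewrite integralE [RHS]integralE.
rewrite !ge0_integral_normal_prob//; last 2 first.
- by apply: measurable_funeneg; exact/measurable_EFinP.
- by apply: measurable_funepos; exact/measurable_EFinP.
congr (_ - _)%E; apply: eq_integral => x _.
  rewrite !funeposE EFinM -[in RHS](mul0e (normal_pdf m s x)%:E).
  by rewrite maxe_pMl// lee_fin normal_pdf_ge0.
rewrite !funenegE EFinM -[in RHS](mul0e (normal_pdf m s x)%:E) -mulNe.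
by rewrite maxe_pMl// lee_fin normal_pdf_ge0.
Qed.

(** * First two moments of the standard normal density *)

Section standard_normal.
Context {R : realType}.
Local Notation phi := (normal_pdf (0 : R) 1).
Local Notation mu := (@lebesgue_measure R).

Lemma std_normal_pdfE (x : R) : phi x = normal_peak 1 * expR (- x ^+ 2 / 2).
Proof. by rewrite normal_pdfE// /normal_fun subr0 expr1n. Qed.

(* Since [x^2 exp(-x^2/2) <= 4 exp(-x^2/4)], a multiple of the density of
   N(0, 2) dominates. *)
Lemma integrable_sqr_normal_pdf :
  mu.-integrable setT (fun x => (x ^+ 2 * phi x)%:E).
Proof.
pose s := Num.sqrt (2 : R).
have s0 : s != 0 by rewrite gt_eqF// sqrtr_gt0.
have ss : s ^+ 2 = 2 by rewrite sqr_sqrtr.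
apply: (@le_integrable _ _ _ mu setT measurableT _
  (fun x => ((4 * normal_peak 1 / normal_peak s)%:E * (normal_pdf 0 s x)%:E))%E) => //.
- apply/measurable_EFinP; apply: measurable_funM => //.
  exact: measurable_normal_pdf.
- move=> x _; rewrite -EFinM !abse_EFin lee_fin std_normal_pdfE normal_pdfE//.
  rewrite /normal_fun subr0 ss.
  have pk := normal_peak_gt0 s0.
  have pk1 := normal_peak_ge0 (1 : R).
  rewrite !ger0_norm; last 2 first.
  - by rewrite !mulr_ge0// ?invr_ge0 ?(ltW pk)// expR_ge0.
  - by rewrite mulr_ge0 ?sqr_ge0// mulr_ge0// expR_ge0.
  rewrite [leRHS]mulrA divfK ?gt_eqF// mulrCA [4 * _]mulrC -[leRHS]mulrA ler_wpM2l//.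
  have -> : - x ^+ 2 / 2 = - x ^+ 2 / (2 *+ 2) - x ^+ 2 / 4 by rewrite -mulr_natr; field.
  rewrite expRD mulrCA [leRHS]mulrC ler_wpM2l ?expR_ge0//.
  rewrite expRN ler_pdivrMr ?expR_gt0//.
  have := expR_ge1Dx (x ^+ 2 / 4); lra.
- apply: integrableZl => //; exact: integrable_normal_pdf.
Qed.

(** Domination by $|x| \le 1 + x^2$. *)
Lemma integrable_id_normal_pdf :
  mu.-integrable setT (fun x => (x * phi x)%:E).
Proof.
apply: (@le_integrable _ _ _ mu setT measurableT _
  (fun x => (phi x)%:E + (x ^+ 2 * phi x)%:E)%E) => //.
- apply/measurable_EFinP; apply: measurable_funM => //.
  exact: measurable_normal_pdf.
- move=> x _; rewrite -EFinD !abse_EFin lee_fin normrM.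
  have p0 := normal_pdf_ge0 0 1 x.
  rewrite (ger0_norm p0) [leRHS]ger0_norm; last first.
    by rewrite addr_ge0// mulr_ge0// sqr_ge0.
  rewrite -[X in X + _]mul1r -mulrDl ler_wpM2r// ler_norml.
  by apply/andP; split; nra.
- by apply: integrableD => //; [exact: integrable_normal_pdf|exact: integrable_sqr_normal_pdf].
Qed.

(** On $[-n, n]$ the integral is $G(n) - G(-n)$, which tends to 0; dominated convergence identifies
    the limit with the full integral. *)
Lemma integral_derive_eq0 (g G : R -> R) :
  continuous g -> (forall x : R, is_derive x (1 : R) G (g x)) ->
  mu.-integrable setT (EFin \o g) ->
  G n%:R @[n --> \oo] --> 0 -> G (- n%:R) @[n --> \oo] --> 0 ->
  (\int[mu]_x (g x)%:E = 0)%E.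
Proof.
move=> cg dG ig G0 GN0.
pose g_ (n : nat) := (EFin \o g) \_ `[- n%:R, n%:R].
have mg : measurable_fun setT (EFin \o g) by exact: measurable_int ig.
have [] := @dominated_convergence _ _ _ mu setT measurableT g_ (EFin \o g)
  (abse \o (EFin \o g)).
- by move=> n; apply/(measurable_restrictT _ _).1 => //; exact: measurable_funTS.
- exact: mg.
- apply: aeW => x _.
  (* Pointwise the truncations are eventually constant, namely once $n \ge |x|$. *)
  apply: cvg_near_cst; near=> n.
  rewrite /g_ patchE ifT// inE /= in_itv /= -ler_norml.
  near: n; exact: nbhs_infty_ger.
- exact: integrable_abse.
- apply: aeW => x n _; rewrite /g_ patchE; case: ifPn => // _.
  by rewrite abse0 abse_ge0.
move=> _ _ cv.
have {}cv : (\int[mu]_x g_ n x @[n --> \oo] --> \int[mu]_x (g x)%:E)%E := cv.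
have : (\int[mu]_x g_ n x @[n --> \oo] --> 0)%E.
  apply: (@cvg_trans _ ((G n%:R - G (- n%:R))%:E @[n --> \oo])).
    apply: near_eq_cvg; near=> n.
    rewrite /g_ -integral_mkcond EFinB; apply/esym.
    apply: continuous_FTC2.
    - have n0 : (0 : R) < n%:R by rewrite ltr0n; near: n; exact: nbhs_infty_gt.
      by rewrite (lt_trans _ n0)// oppr_lt0.
    - exact: continuous_subspaceT.
    - have DG (x : R) : derivable G x 1 by have [] := dG x.
      have cG (x : R) : {for x, continuous G}.
        exact/differentiable_continuous/derivable1_diffP.
      split => [x _||]; first exact: DG.
      + exact/cvg_at_right_filter/cG.
      + exact/cvg_at_left_filter/cG.
    - by move=> x _; rewrite derive1E derive_val.
  apply: cvg_EFin; first by near=> n.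
  by rewrite -[X in _ --> X](subr0 0); apply: cvgB.
by move/cvg_unique => /(_ _ _ cv) ->.
Unshelve. all: by end_near. Qed.

Lemma is_derive_std_normal_pdf (x : R) :
  is_derive x (1 : R) phi (- (x * phi x)).
Proof.
have -> : phi = fun x => normal_peak 1 * expR (- x ^+ 2 / 2).
  by apply/funext => y; rewrite std_normal_pdfE.
by apply: is_derive_eq; rewrite !scaler0 /GRing.scale /=; field.
Qed.

Lemma is_derive_mul_std_normal_pdf (x : R) :
  is_derive x (1 : R) (fun y => - (y * phi y)) ((x ^+ 2 - 1) * phi x).
Proof.
have ? := is_derive_std_normal_pdf x.
by apply: is_derive_eq; rewrite /GRing.scale /=; ring.
Qed.

(** From $e^y \ge 1 + y$ at $y = n^2/2$. The factor [Num.max 1 |x|] serves both primitives used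
    below, $-\varphi$ and $-x\varphi$. *)
Lemma std_normal_pdf_decay (n : nat) (x : R) : `|x| = n%:R ->
  Num.max 1 `|x| * phi x <= 4 * normal_peak 1 * harmonic n.
Proof.
move=> xn; have x2 : x ^+ 2 = n%:R ^+ 2 by rewrite -real_normK ?num_real// xn.
rewrite std_normal_pdfE xn x2 mulrCA [4 * _]mulrC -[leRHS]mulrA.
rewrite ler_wpM2l ?normal_peak_ge0// mulNr expRN /harmonic /=.
rewrite ler_pdivrMr ?expR_gt0// [leRHS]mulrAC ler_pdivlMr ?ltr0n//.
have := expR_ge1Dx (n%:R ^+ 2 / 2 : R); rewrite -[n.+1%:R]natr1.
have n0 : (0 : R) <= n%:R by [].
by rewrite maxEle; case: ifP => _ h; nra.
Qed.

Lemma cvg0_le_std_normal_pdf (G : R -> R) (e : nat -> R) :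
  (forall n, `|e n| = n%:R) -> (forall x, `|G x| <= Num.max 1 `|x| * phi x) ->
  G (e n) @[n --> \oo] --> 0.
Proof.
move=> en Gle; apply: norm_cvg0.
apply: (@squeeze_cvgr _ _ _ _ (cst 0) (fun n => 4 * normal_peak 1 * harmonic n)).
- apply: nearW => n; rewrite normr_ge0 /=.
  by apply: le_trans (Gle _) _; exact: std_normal_pdf_decay.
- exact: cvg_cst.
- rewrite -[X in _ --> X](mulr0 (4 * normal_peak 1)).
  by apply: cvgMr; exact: cvg_harmonic.
Qed.

Lemma integral_id_std_normal_pdf : (\int[mu]_x (x * phi x)%:E = 0)%E.
Proof.
have cphi : continuous phi by exact: continuous_normal_pdf.
have bnd (x : R) : `|- phi x| <= Num.max 1 `|x| * phi x.
  rewrite normrN ger0_norm ?normal_pdf_ge0// ler_peMl ?normal_pdf_ge0//.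
  by rewrite le_max lexx.
apply: (integral_derive_eq0 _ (fun x => - phi x)).
- by move=> x; apply: cvgM; [exact: cvg_id|exact: cphi].
- move=> x; have ? := is_derive_std_normal_pdf x.
  by apply: is_derive_eq; rewrite opprK.
- exact: integrable_id_normal_pdf.
- by apply: (@cvg0_le_std_normal_pdf (fun x => - phi x)) => // n; rewrite normr_nat.
- by apply: (@cvg0_le_std_normal_pdf (fun x => - phi x) (fun n => - n%:R)) => // n;
     rewrite normrN normr_nat.
Qed.

(** The function $(x^2 - 1)\varphi$ has the vanishing primitive $-x\varphi$, so the second moment
    equals the total mass. *)
Lemma integral_sqr_std_normal_pdf : (\int[mu]_x (x ^+ 2 * phi x)%:E = 1)%E.
Proof.
have cphi : continuous phi by exact: continuous_normal_pdf.
have bnd (x : R) : `|- (x * phi x)| <= Num.max 1 `|x| * phi x.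
  rewrite normrN normrM (ger0_norm (normal_pdf_ge0 _ _ _)).
  by rewrite ler_wpM2r ?normal_pdf_ge0// le_max lexx orbT.
have e x : ((x ^+ 2 - 1) * phi x)%:E = ((x ^+ 2 * phi x)%:E - (phi x)%:E)%E.
  by rewrite -EFinB mulrBl mul1r.
have i2 := integrable_sqr_normal_pdf.
have i1 := integrable_normal_pdf (0 : R) 1.
have : (\int[mu]_x ((x ^+ 2 - 1) * phi x)%:E = 0)%E.
  apply: (integral_derive_eq0 _ (fun x => - (x * phi x))).
  - move=> x; apply: cvgM; last exact: cphi.
    by apply: cvgB; [exact: exprn_continuous|exact: cvg_cst].
  - exact: is_derive_mul_std_normal_pdf.
  - rewrite [X in mu.-integrable _ X](_ : _ =
        ((fun x => (x ^+ 2 * phi x)%:E) \- (fun x => (phi x)%:E))%E).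
      exact: integrableB.
    by apply/funext => x; exact: e.
  - by apply: (@cvg0_le_std_normal_pdf (fun x => - (x * phi x))) => // n; rewrite normr_nat.
  - by apply: (@cvg0_le_std_normal_pdf (fun x => - (x * phi x)) (fun n => - n%:R)) => // n;
     rewrite normrN normr_nat.
under eq_integral do rewrite e.
rewrite integralB// integral_normal_pdf.
(* The second moment is finite, so the extended-real equation can be solved for it. *)
by rewrite -(fineK (integrable_fin_num measurableT i2)) => -[/subr0_eq ->].
Qed.

End standard_normal.

(** * Moments of a random variable with standard normal law *)

Section standard_normal_variable.
Context {R : realType} {d : measure_display} {T : measurableType d}.
Variables (P : probability T R) (X : T -> R).
Hypothesis mX : measurable_fun setT X.
Hypothesis lawX : forall A, measurable A -> P (X @^-1` A) = normal_prob 0 1 A.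

Let rvX : {mfun T >-> measurableTypeR R} :=
  HB.pack X (isMeasurableFun.Build _ _ T (measurableTypeR R) X mX).

Let integral_law (f : R -> \bar R) :
  (\int[distribution P rvX]_y f y = \int[normal_prob 0 1]_y f y)%E.
Proof. by apply: eq_measure_integral => A mA _; exact: lawX. Qed.

Lemma std_normal_sqr_expectation : (\int[P]_w (X w ^+ 2)%:E = 1)%E.
Proof.
rewrite -integral_sqr_std_normal_pdf -integral_normal_prob//.
rewrite -integral_law ge0_integral_distribution//.
  by apply/measurable_EFinP; exact: measurable_funX.
by move=> x; rewrite lee_fin sqr_ge0.
Qed.

Lemma std_normal_Lfun2 : X \in Lfun P 2%:E.
Proof.
apply: Lfun2_sqr_integrable => //; apply/integrableP; split.
  by apply/measurable_EFinP; exact: measurable_funX.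
under eq_integral => x _ do rewrite abse_EFin ger0_norm ?sqr_ge0//.
by rewrite std_normal_sqr_expectation ltry.
Qed.

Lemma std_normal_expectation : ('E_P[X] = 0)%E.
Proof.
rewrite unlock -integral_id_std_normal_pdf -integral_normal_prob//.
rewrite -integral_law integral_distribution//.
apply/Lfun1_integrable; apply: (Lfun_subset12 _ std_normal_Lfun2).
exact: fin_num_measure.
Qed.

Lemma std_normal_variance : ('V_P[X] = 1)%E.
Proof.
rewrite varianceE ?std_normal_Lfun2// std_normal_expectation expe2 mule0 sube0.
by rewrite unlock -std_normal_sqr_expectation.
Qed.

End standard_normal_variable.

(** * Uncorrelatedness from independence *)

(** Independence makes the joint law the product of the marginals, and Fubini then factors
    $E[XY]$. *)
Lemma indep_covariance0 (R : realType) (d : measure_display)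
  (T : measurableType d) (P : probability T R) (X Y : T -> R) :
  measurable_fun setT X -> measurable_fun setT Y ->
  X \in Lfun P 2%:E -> Y \in Lfun P 2%:E ->
  (forall A B, measurable A -> measurable B ->
    P (X @^-1` A `&` Y @^-1` B) = (P (X @^-1` A) * P (Y @^-1` B))%E) ->
  (covariance P X Y = 0)%E.
Proof.
move=> mX mY X2 Y2 XY.
have Pfin : P setT \is a fin_num := fin_num_measure P _ measurableT.
have X1 := Lfun_subset12 Pfin X2.
have Y1 := Lfun_subset12 Pfin Y2.
have XY1 := Lfun2_mul_Lfun1 X2 Y2.
rewrite covarianceE//.
pose mfX : {mfun T >-> R} := HB.pack X (isMeasurableFun.Build _ _ _ _ X mX).
pose mfY : {mfun T >-> R} := HB.pack Y (isMeasurableFun.Build _ _ _ _ Y mY).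
have mpair : measurable_fun setT (fun w => (X w, Y w)) by exact: measurable_fun_pair.
pose mfXY : {mfun T >-> (R * R)%type} :=
  HB.pack (fun w => (X w, Y w)) (isMeasurableFun.Build _ _ _ _ _ mpair).
pose PX := distribution P mfX; pose PY := distribution P mfY.
pose PXY := distribution P mfXY.
(* Agreement on rectangles, which is the independence hypothesis, determines the product measure. *)
have PXYE A : measurable A -> (PX \x PY)%E A = PXY A.
  by move=> mA; apply: product_measure_unique.
pose f (z : R * R) := (z.1 * z.2)%:E.
have mf : measurable_fun setT f.
  by apply/measurable_EFinP; apply: measurable_funM.
have iXY : P.-integrable setT (f \o (fun w => (X w, Y w))).
  exact/Lfun1_integrable.
(* Fubini needs integrability under the product; it is transported from $XY \in L^1$, a consequence
   of $X, Y \in L^2$. *)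
have iprod : (PX \x PY)%E.-integrable setT f.
  apply/integrableP; split => //.
  rewrite (eq_measure_integral PXY); last by move=> A mA _; exact: PXYE.
  by have /integrableP[] := integrable_pushforward mpair mf iXY measurableT.
have -> : 'E_P[X * Y]%E = ('E_P[X] * 'E_P[Y])%E.
  rewrite unlock.
  transitivity (\int[PXY]_z f z)%E; first by rewrite integral_pushforward.
  transitivity (\int[(PX \x PY)%E]_z f z)%E.
    by apply: eq_measure_integral => A mA _; exact/esym/PXYE.
  rewrite -integral12_prod_meas1//.
  have iX : PX.-integrable setT (EFin : R -> \bar R).
    by apply: integrable_pushforward => //; exact/Lfun1_integrable.
  have iY : PY.-integrable setT (EFin : R -> \bar R).
    by apply: integrable_pushforward => //; exact/Lfun1_integrable.
  transitivity (\int[PX]_x (x%:E * \int[PY]_y y%:E))%E.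
    by apply: eq_integral => x _; rewrite /fubini_F -integralZl.
  have EY : (\int[PY]_y y%:E = \int[P]_w (Y w)%:E)%E.
    by rewrite integral_pushforward//; exact/Lfun1_integrable.
  have EX : (\int[PX]_x x%:E = \int[P]_w (X w)%:E)%E.
    by rewrite integral_pushforward//; exact/Lfun1_integrable.
  have finY : (\int[P]_w (Y w)%:E)%E \is a fin_num.
    by apply: integrable_fin_num => //; exact/Lfun1_integrable.
  by rewrite EY -(fineK finY) integralZr// EX.
by rewrite subee// fin_numM// expectation_fin_num.
Qed.

Lemma mutually_independent_pair (R : realType) (d : measure_display)
  (T : measurableType d) (P : probability T R) (I : eqType) (Y : I -> T -> R)
  (k l : I) (A B : set R) :
  mutually_independent P Y -> k != l -> measurable A -> measurable B ->
  P (Y k @^-1` A `&` Y l @^-1` B) = (P (Y k @^-1` A) * P (Y l @^-1` B))%E.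
Proof.
(* Mutual independence asks for a set at every index; only the values of [S] at [k] and [l]
   matter. *)
move=> indY kl mA mB; pose S i := if i == k then A else B.
have uniq_kl : uniq [:: k; l] by rewrite /= inE kl.
have mS i : measurable (S i) by rewrite /S; case: ifP.
have Sl : S l = B by rewrite /S eq_sym (negbTE kl).
have Sk : S k = A by rewrite /S eqxx.
have := indY _ uniq_kl S mS; rewrite !big_cons big_nil mule1 Sk Sl => <-.
congr (P _); apply/seteqP; split => [w [wA wB] i /=|w wS].
  by rewrite !inE => /orP[] /eqP ->; rewrite ?Sk ?Sl.
split; first by rewrite /= -Sk; apply: (wS k); rewrite /= inE eqxx.
by rewrite /= -Sl; apply: (wS l); rewrite /= !inE eqxx orbT.
Qed.

(** * Covariances along the layers *)

Section real_covariance.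
Context {R : realType} {d : measure_display} {T : measurableType d}.
Variable P : probability T R.
Implicit Types f g h : T -> R.
Local Notation L2 := (Lfun P 2%:E).

(** Covariances are finite on $L^2$, so taking [fine] lets the layer computation run in the field
    [R]. *)
Definition cov f g : R := fine (covariance P f g).

Lemma covC f g : cov f g = cov g f.
Proof. by rewrite /cov covarianceC. Qed.

Let Pfin : P setT \is a fin_num := fin_num_measure P _ measurableT.

Let cov_fin f g : f \in L2 -> g \in L2 -> covariance P f g \is a fin_num.
Proof.
move=> f2 g2; have f1 := Lfun_subset12 Pfin f2; have g1 := Lfun_subset12 Pfin g2.
by rewrite covariance_fin_num//; exact: Lfun2_mul_Lfun1.
Qed.

Lemma covDl f g h : f \in L2 -> g \in L2 -> h \in L2 ->
  cov (f + g) h = cov f h + cov g h.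
Proof. by move=> f2 g2 h2; rewrite /cov covarianceDl// fineD// cov_fin. Qed.

Lemma covZl a f h : f \in L2 -> h \in L2 -> cov (a *: f) h = a * cov f h.
Proof.
move=> f2 h2; have -> : a *: f = a \o* f by apply/funext => x /=; exact: mulrC.
have f1 := Lfun_subset12 Pfin f2; have h1 := Lfun_subset12 Pfin h2.
rewrite /cov covarianceZl//; last exact: Lfun2_mul_Lfun1.
by rewrite fineM// cov_fin.
Qed.

Lemma cov0l h : h \in L2 -> cov 0 h = 0.
Proof. by move=> h2; rewrite /cov covariance_cst_l. Qed.

Lemma Lfun2Z a f : f \in L2 -> a *: f \in L2.
Proof.
move=> f2; have -> : a *: f = a \o* f by apply/funext => x /=; exact: mulrC.
by apply: Lfun_scale => //; rewrite ler1n.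
Qed.

Lemma Lfun2D f g : f \in L2 -> g \in L2 -> f + g \in L2.
Proof. by move=> f2 g2; rewrite rpredD ?lee1n. Qed.

Lemma Lfun2_lin n (c : 'I_n -> R) (F : 'I_n -> T -> R) :
  (forall i, F i \in L2) -> \sum_(i < n) c i *: F i \in L2.
Proof.
move=> F2; apply: (big_ind (fun f => f \in L2)).
- exact: Lfun_cst.
- exact: Lfun2D.
- by move=> i _; apply: Lfun2Z.
Qed.

Lemma cov_suml n (c : 'I_n -> R) (F : 'I_n -> T -> R) h :
  (forall i, F i \in L2) -> h \in L2 ->
  cov (\sum_(i < n) c i *: F i) h = \sum_(i < n) c i * cov (F i) h.
Proof.
move=> F2 h2; elim: n c F F2 => [|n IH] c F F2; first by rewrite !big_ord0 cov0l.
by rewrite !big_ord_recr /= covDl ?IH ?covZl ?Lfun2Z ?Lfun2_lin.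
Qed.

Lemma cov_CauchySchwarz f g : f \in L2 -> g \in L2 ->
  cov f g <= Num.sqrt (cov f f) * Num.sqrt (cov g g).
Proof.
move=> f2 g2; have := covariance_le f2 g2.
rewrite -(fineK (cov_fin _ _ f2 g2)) /variance.
rewrite -(fineK (cov_fin _ _ f2 f2)) -(fineK (cov_fin _ _ g2 g2)).
by rewrite /= -EFinM lee_fin.
Qed.

End real_covariance.

(** * Covariances of the broadcast variables, driven by uncorrelated unit-variance inputs *)

Section broadcast_covariance.
Context {R : realType} {d : measure_display} {T : measurableType d}.
Variables (P : probability T R) (X0 : T -> R) (W : nat -> nat -> bool -> T -> R).
Local Notation L2 := (Lfun P 2%:E).
Local Notation X := (bX 1 2^-1 X0 W).
Hypothesis X02 : X0 \in L2.
Hypothesis W2 : forall i j b, W i j b \in L2.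
Hypothesis covX0 : cov P X0 X0 = 1.
Hypothesis covX0W : forall i j b, cov P X0 (W i j b) = 0.
Hypothesis covWW : forall i j b k l c,
  cov P (W i j b) (W k l c) = [&& i == k, j == l & b == c]%:R.

Lemma bX_S0 i : X i.+1 0 = X i 0 + W i 0 true.
Proof. by apply/funext => w; rewrite /= mul1r. Qed.

Lemma bX_0S j : X 0 j.+1 = X 0 j + W 0 j false.
Proof. by apply/funext => w; rewrite /= mul1r. Qed.

Lemma bX_SS i j : X i.+1 j.+1
  = 2^-1 *: (X i j.+1 + W i j.+1 true + (X i.+1 j + W i.+1 j false)).
Proof. by []. Qed.

Lemma bX_Lfun2 i j : X i j \in L2.
Proof.
elim: i j => [|i IHi]; elim=> [|j IHj] //.
- by rewrite bX_0S Lfun2D.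
- by rewrite bX_S0 Lfun2D.
- by rewrite bX_SS Lfun2Z// !Lfun2D.
Qed.
Local Hint Resolve bX_Lfun2 W2 X02 : core.

Lemma cov_bX_S0 i g : g \in L2 ->
  cov P (X i.+1 0) g = cov P (X i 0) g + cov P (W i 0 true) g.
Proof. by move=> g2; rewrite bX_S0 covDl. Qed.

Lemma cov_bX_0S j g : g \in L2 ->
  cov P (X 0 j.+1) g = cov P (X 0 j) g + cov P (W 0 j false) g.
Proof. by move=> g2; rewrite bX_0S covDl. Qed.

Lemma cov_bX_SS i j g : g \in L2 ->
  cov P (X i.+1 j.+1) g = 2^-1 * (cov P (X i j.+1) g + cov P (W i j.+1 true) g
    + (cov P (X i.+1 j) g + cov P (W i.+1 j false) g)).
Proof. by move=> g2; rewrite bX_SS covZl ?covDl// ?Lfun2D. Qed.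

(** Each vertex averages its parents, as $1 \cdot 1 = 2 \cdot \frac12 = 1$, and the noises are
    uncorrelated with [X0]. *)
Lemma cov_bX_X0 i j : cov P (X i j) X0 = 1.
Proof.
have WX0 k l b : cov P (W k l b) X0 = 0 by rewrite covC.
elim: i j => [|i IHi]; elim=> [|j IHj] //.
- by rewrite cov_bX_0S// IHj WX0 addr0.
- by rewrite cov_bX_S0// IHi WX0 addr0.
- by rewrite cov_bX_SS// IHi IHj !WX0; field.
Qed.

(** Only noises leaving strictly lower layers enter $X_{(i,j)}$; a noise leaving its own or a higher
    layer is fresh. *)
Lemma cov_bX_W i j k l b : (i + j <= k + l)%N -> cov P (X i j) (W k l b) = 0.
Proof.
have WW0 i' j' b' : (i' + j' < k + l)%N -> cov P (W i' j' b') (W k l b) = 0.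
  by move=> lt; rewrite covWW; case: eqP => //= ei; case: eqP => //= ej; lia.
elim: i j => [|i IHi]; elim=> [|j IHj] // le.
- by rewrite cov_bX_0S// IHj ?WW0 ?addr0//; lia.
- by rewrite cov_bX_S0// IHi ?WW0 ?addr0//; lia.
- by rewrite cov_bX_SS// IHi ?IHj ?WW0 ?addr0 ?mulr0//; lia.
Qed.

Lemma cov_W_bX i j k l b : (k + l <= i + j)%N -> cov P (W i j b) (X k l) = 0.
Proof. by rewrite covC; exact: cov_bX_W. Qed.

Local Notation D i k := (`|i%:Z - k%:Z|%:~R : R).

Let DC (i k : nat) : D i k = D k i.
Proof. by congr (_%:~R); lia. Qed.

Let DE (i k : nat) : (k <= i)%N -> D i k = i%:R - k%:R.
Proof. by move=> ki; rewrite ger0_norm ?rmorphB//; lia. Qed.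

Let D0l (k : nat) : D 0%N k = k%:R.
Proof. by rewrite DC DE// subr0. Qed.

Let D0r (k : nat) : D k 0%N = k%:R.
Proof. by rewrite DE// subr0. Qed.

Let DSS (i k : nat) : D i.+1 k.+1 = D i k.
Proof. by congr (_%:~R); lia. Qed.

(** The kink identity again, solved for one term. It lets the noise variance cancel in the interior
    case of [cov_layer]. *)
Let DS (i k : nat) : D i.+1 k = 2 * D i k + 2 * (i == k)%:R - D i k.+1.
Proof.
apply/eqP; rewrite eq_sym subr_eq; apply/eqP.
have : (`|i.+1%:Z - k%:Z| + `|i%:Z - k.+1%:Z| = 2 * `|i%:Z - k%:Z| + 2 * (i == k)%:Z).
  by lia.
by move=> /(congr1 (fun z : int => z%:~R : R)); rewrite !rmorphD !rmorphM.
Qed.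

Let cov_layer_sym t i j k l :
  cov P (X i j) (X k l) = 1 + mean_dist R t i%:Z + mean_dist R t k%:Z - D i k ->
  cov P (X k l) (X i j) = 1 + mean_dist R t k%:Z + mean_dist R t i%:Z - D k i.
Proof. by rewrite covC => ->; rewrite DC; ring. Qed.

(** Both vertices are expanded over their parents, and cross terms with fresh noise vanish. In the
    interior, the variance of shared noise is exactly the kink of $|i - k|$. At a corner, the added
    unit variance matches the growth of $2 m_t$ by 1. *)
Lemma cov_layer t i j k l : (i + j = t)%N -> (k + l = t)%N ->
  cov P (X i j) (X k l) = 1 + mean_dist R t i%:Z + mean_dist R t k%:Z - D i k.
Proof.
elim: t i j k l => [|t IH] i j k l.
  move=> /eqP; rewrite addn_eq0 => /andP[/eqP-> /eqP->].
  move=> /eqP; rewrite addn_eq0 => /andP[/eqP-> /eqP->].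
  by rewrite [cov _ _ _]covX0 mean_dist_left subrr normr0 mul0r !addr0 subr0.
have XW0 a b c e f : (a + b = t)%N -> (c + e = t)%N -> cov P (X a b) (W c e f) = 0.
  by move=> h1 h2; apply: cov_bX_W; rewrite h1 h2.
have WX0 a b c e f : (a + b = t)%N -> (c + e = t)%N -> cov P (W c e f) (X a b) = 0.
  by move=> h1 h2; apply: cov_W_bX; rewrite h1 h2.
have tS : t.+1%:R = t%:R + 1 :> R by rewrite natr1.
have left_right : cov P (X 0 t.+1) (X t.+1 0)
    = 1 + mean_dist R t.+1 0%N%:Z + mean_dist R t.+1 t.+1%:Z - D 0%N t.+1.
  rewrite cov_bX_0S// ![cov P _ (X t.+1 0)]covC !cov_bX_S0//.
  rewrite IH ?addn0// XW0 ?WX0 ?addn0// covWW !andbF.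
  rewrite !mean_dist_left !mean_dist_right D0l D0r tS /=.
  by field.
have left_int p q : (p + q).+1 = t -> cov P (X 0 t.+1) (X p.+1 q.+1)
    = 1 + mean_dist R t.+1 0%N%:Z + mean_dist R t.+1 p.+1%:Z - D 0%N p.+1.
  move=> kl; have [kl1 kl2] : (p + q.+1 = t)%N /\ (p.+1 + q = t)%N by lia.
  rewrite cov_bX_0S// ![cov P _ (X p.+1 q.+1)]covC !cov_bX_SS//.
  rewrite ![cov P _ (X 0 t)]covC.
  rewrite !(IH 0%N t)// !XW0// !covWW !andbF /=.
  rewrite !mean_dist_left mean_dist_succ !D0l tS -[p.+1%:R]natr1.
  by field.
have right_int p q : (p + q).+1 = t -> cov P (X t.+1 0) (X p.+1 q.+1)
    = 1 + mean_dist R t.+1 t.+1%:Z + mean_dist R t.+1 p.+1%:Z - D t.+1 p.+1.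
  move=> kl; have [kl1 kl2] : (p + q.+1 = t)%N /\ (p.+1 + q = t)%N by lia.
  have t0 : (t + 0 = t)%N by rewrite addn0.
  rewrite cov_bX_S0// ![cov P _ (X p.+1 q.+1)]covC !cov_bX_SS//.
  rewrite !(IH _ _ t 0%N)// !XW0// !WX0// !covWW !andbF /=.
  rewrite !mean_dist_right mean_dist_succ (DC p t) (DC p.+1 t) !DE; try by lia.
  by rewrite tS -[p.+1%:R]natr1; field.
(* Each vertex is the left corner, the right corner or interior, which leaves nine cases; some
   reduce to others by symmetry. *)
case: i j k l => [|i] [|j] [|k] [|l] // ij kl.
- have [? ?] : j = t /\ l = t by lia. subst j l.
  rewrite cov_bX_0S// ![cov P _ (X 0 t.+1)]covC !cov_bX_0S//.
  rewrite IH// XW0// WX0// covWW !eqxx !mean_dist_left tS /=.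
  by rewrite subrr normr0; field.
- have [? ?] : j = t /\ k = t by lia. by subst j k.
- have ? : j = t by lia. by subst j; apply: left_int; lia.
- have [? ?] : i = t /\ l = t by lia. by subst i l; exact: cov_layer_sym.
- have [? ?] : i = t /\ k = t by lia. subst i k.
  have t0 : (t + 0 = t)%N by rewrite addn0.
  rewrite cov_bX_S0// ![cov P _ (X t.+1 0)]covC !cov_bX_S0//.
  rewrite IH// XW0// WX0// covWW !eqxx !mean_dist_right tS /=.
  by rewrite !subrr normr0; field.
- have ? : i = t by lia. by subst i; apply: right_int; lia.
- have ? : l = t by lia. by subst l; apply: cov_layer_sym; apply: left_int; lia.
- have ? : k = t by lia. by subst k; apply: cov_layer_sym; apply: right_int; lia.
- have [ij1 ij2] : (i + j.+1 = t)%N /\ (i.+1 + j = t)%N by lia.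
  have [kl1 kl2] : (k + l.+1 = t)%N /\ (k.+1 + l = t)%N by lia.
  rewrite cov_bX_SS// ![cov P _ (X k.+1 l.+1)]covC !cov_bX_SS//.
  rewrite !IH// !XW0// !WX0// !covWW !andbF !andbT !eqSS !mean_dist_succ.
  (* On a common layer one coordinate determines the other, so either both incoming noises are
     shared or neither is. *)
  have -> : (l == j) = (k == i) by lia.
  rewrite !andbb !DSS ![D k.+1 i]DS ![D k i.+1]DC ![D k i]DC /=.
  by field.
Qed.

(** * Optimality of the binomial combination *)

Definition binomial_sum t : T -> R :=
  \sum_(i < t.+1) 'C(t, i)%:R *: X i (t - i).

Lemma binomial_sum_Lfun2 t : binomial_sum t \in L2.
Proof. exact: Lfun2_lin. Qed.
Local Hint Resolve binomial_sum_Lfun2 : core.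

(** The value of $E|B - B'|$. *)
Local Notation M t := (t%:R / 4 ^+ t * 'C(t.*2, t)%:R : R).

Lemma cov_bX_binomial_sum t i : (i <= t)%N ->
  cov P (X i (t - i)) (binomial_sum t) = 2 ^+ t * (1 + M t).
Proof.
move=> it; rewrite covC cov_suml//.
under eq_bigr => k _.
  have kt : (k <= t)%N by rewrite -ltnS.
  rewrite (@cov_layer t) ?subnKC// DC !mulrDr mulrN mulr1; over.
rewrite sumrB !big_split /= -mulr_suml sum_binomial sum_binomial_mean_dist.
(* The average of $|i - k|$ becomes [mean_dist R t i], and [addrK] cancels it, removing the
   dependence on [i]. *)
by rewrite (iter_half_avg _ (fun x : int => `|x|%:~R)) -/(mean_dist R t i) addrK; ring.
Qed.

Lemma cov_lin_binomial_sum t (c : 'I_t.+1 -> R) :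
  cov P (\sum_(i < t.+1) c i *: X i (t - i)) (binomial_sum t)
  = 2 ^+ t * (1 + M t) * \sum_(i < t.+1) c i.
Proof.
rewrite cov_suml// mulr_sumr; apply: eq_bigr => i _.
by rewrite cov_bX_binomial_sum 1?mulrC// -ltnS.
Qed.

Lemma cov_lin_X0 t (c : 'I_t.+1 -> R) :
  cov P (\sum_(i < t.+1) c i *: X i (t - i)) X0 = \sum_(i < t.+1) c i.
Proof.
by rewrite cov_suml//; apply: eq_bigr => i _; rewrite cov_bX_X0 mulr1.
Qed.

Let M1_gt0 t : 0 < M t + 1.
Proof. by rewrite ltr_wpDl// !mulr_ge0// invr_ge0 exprn_ge0. Qed.

Lemma corr_ratioE f g : corr_ratio P f g = cov P f g / Num.sqrt (cov P f f).
Proof. by []. Qed.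

Lemma corr_ratio_binomial_sum t :
  corr_ratio P (binomial_sum t) X0 = 1 / Num.sqrt (M t + 1).
Proof.
have p0 : (0 : R) < 2 ^+ t by rewrite exprn_gt0.
rewrite corr_ratioE cov_lin_X0 cov_lin_binomial_sum sum_binomial.
(* The variance is $(2^t)^2 (M + 1)$ and the covariance with [X0] is $2^t$. *)
rewrite mulrAC -expr2 addrC sqrtrM ?sqr_ge0// sqrtr_sqr (ger0_norm (ltW p0)).
by rewrite invfM mulrA divff ?gt_eqF.
Qed.

(** Cauchy-Schwarz against [binomial_sum t], whose covariance with the combination is a fixed
    positive multiple of the coefficient sum, that is, of the covariance with [X0]. *)
Lemma corr_ratio_le_binomial_sum t (c : 'I_t.+1 -> R) :
  corr_ratio P (\sum_(i < t.+1) c i *: X i (t - i)) X0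
  <= corr_ratio P (binomial_sum t) X0.
Proof.
rewrite corr_ratio_binomial_sum corr_ratioE cov_lin_X0.
set f : T -> R := \sum_(i < t.+1) c i *: _; set s := \sum_(i < t.+1) c i.
set r := Num.sqrt (M t + 1).
have r0 : 0 < r by rewrite sqrtr_gt0.
have r2 : r ^+ 2 = M t + 1 by rewrite sqr_sqrtr// ltW.
have p0 : (0 : R) < 2 ^+ t by rewrite exprn_gt0.
have f2 : f \in L2 by exact: Lfun2_lin.
have := cov_CauchySchwarz P f (binomial_sum t) f2 (binomial_sum_Lfun2 t).
rewrite !cov_lin_binomial_sum sum_binomial -/s.
rewrite [2 ^+ t * _ * 2 ^+ t]mulrAC -expr2 sqrtrM ?sqr_ge0//.
rewrite sqrtr_sqr (ger0_norm (ltW p0)) (addrC 1) -/r -r2 => CS.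
(* Cauchy-Schwarz divided by the positive factor $2^t r$, using $M + 1 = r^2$. *)
have {}CS : r * s <= Num.sqrt (cov P f f).
  rewrite -(ler_pM2l (mulr_gt0 p0 r0)); rewrite [leRHS]mulrC.
  apply: le_trans (CS).
  by rewrite le_eqVlt; apply/orP; left; apply/eqP; ring.
have := sqrtr_ge0 (cov P f f); rewrite le_eqVlt => /orP[/eqP <-|q0].
  (* zero variance: the ratio has the junk value 0 *)
  by rewrite invr0 mulr0 divr_ge0// ltW.
by rewrite ler_pdivrMr// mulrAC ler_pdivlMr// mul1r mulrC.
Qed.

End broadcast_covariance.

(** * From the Gaussian model to its covariances *)

Theorem mainTheorem2 (R : realType) (d : measure_display) (T : measurableType d)
  (P : probability T R) (X0 : T -> R) (W : nat -> nat -> bool -> T -> R) :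
  measurable_fun setT X0 ->
  (forall i j b, measurable_fun setT (W i j b)) ->
  (forall A, measurable A -> P (X0 @^-1` A) = normal_prob 0 1 A) ->
  (forall i j b A, measurable A -> P (W i j b @^-1` A) = normal_prob 0 1 A) ->
  mutually_independent P (bfamily X0 W) ->
  forall t : nat,
  let X := bX 1 (2^-1) X0 W in
  let zhat := fun w => \sum_(i < t.+1) ('C(t, i))%:R * X i (t - i)%N w in
  corr_ratio P zhat X0
    = 1 / Num.sqrt (t%:R / 4 ^+ t * ('C(t.*2, t))%:R + 1)
  /\ forall c : 'I_t.+1 -> R, (exists i, c i != 0) ->
     corr_ratio P (fun w => \sum_(i < t.+1) c i * X i (t - i)%N w) X0
       <= corr_ratio P zhat X0.
Proof.
move=> mX0 mW lawX0 lawW indXW t X zhat.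
have mY k : measurable_fun setT (bfamily X0 W k).
  by case: k => [[[i j] b]|]; [exact: mW|exact: mX0].
have Y2 k : bfamily X0 W k \in Lfun P 2%:E.
  case: k => [[[i j] b]|] /=.
    exact: (std_normal_Lfun2 _ _ (mW i j b) (lawW i j b)).
  exact: (std_normal_Lfun2 _ _ mX0 lawX0).
(* All that the argument takes from independence and normality, beyond square integrability: the
   inputs are uncorrelated with unit variance. *)
have covY k l : cov P (bfamily X0 W k) (bfamily X0 W l) = (k == l)%:R.
  have [<-|kl] := eqVneq k l.
    rewrite /cov -/(variance P _); case: k => [[[i j] b]|] /=.
      by rewrite (std_normal_variance _ _ (mW i j b) (lawW i j b)).
    by rewrite (std_normal_variance _ _ mX0 lawX0).
  rewrite /cov indep_covariance0// => A B mA mB.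
  exact: mutually_independent_pair.
have X02 := Y2 None.
have W2 i j b := Y2 (Some ((i, j), b)).
have covX0 := covY None None.
have covX0W i j b := covY None (Some ((i, j), b)).
have covWW i j b k l c : cov P (W i j b) (W k l c) = [&& i == k, j == l & b == c]%:R.
  by rewrite andbA; exact: (covY (Some ((i, j), b)) (Some ((k, l), c))).
have linE (c : 'I_t.+1 -> R) : (fun w => \sum_(i < t.+1) c i * X i (t - i)%N w)
    = \sum_(i < t.+1) c i *: X i (t - i)%N.
  by apply/funext => w; rewrite fct_sumE.
rewrite /zhat linE; split; first exact: corr_ratio_binomial_sum.
by move=> c _; rewrite linE; exact: corr_ratio_le_binomial_sum.
Qed.
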